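(* For every $0<\delta<1$ there exists a constant $t_\delta$ such that $$\limsup_{K\to\infty}\ p^{\mathrm{SWT}}_{K,\lfloor\delta K\rfloor}\big(t_\delta K^2\big)=0,$$ where $p^{\mathrm{SWT}}_{K,s}(t)$ is the maximal transience probability at time $t$ of the SSEP with traps on $\mathbb{T}_K$ over initial configurations with $s$ excess particles.
   Context: For an integer $K\ge 1$ let $\mathbb{T}_K=\{1,\dots,K\}$ be the periodic ring (indices mod $K$) and $\Gamma_K=\{n\in\mathbb{Z}: n\le 1\}^{\mathbb{T}_K}$. The SSEP with traps (SWT) on $\mathbb{T}_K$ is the continuous-time Markov process on $\Gamma_K$ with generator $$\mathscr{L}f(\xi)=\sum_{k\in\mathbb{T}_K}\sum_{z=\pm1}\mathbf{1}_{\{\xi_k=1,\ \xi_{k+z}\le 0\}}\{f(\xi^{k,k+z})-f(\xi)\},$$ where $\xi^{k,k+z}$ equals $0$ at $k$, $\xi_{k+z}+1$ at $k+z$, and $\xi_{k'}$ at every other site $k'$. Let $\mathbf{P}^K_\xi$ be its law started from $\xi$. Set $|\xi^-|=-\sum_k\min(\xi_k,0)$, $|\xi^+|=\sum_k\mathbf{1}_{\{\xi_k=1\}}$, and $S(\xi)=\sum_k\xi_k=|\xi^+|-|\xi^-|$ (number of excess particles). Transient configurations: $\mathcal{T}_K^{\mathrm{SWT}}=\{\xi\in\Gamma_K: |\xi^-|>0,\ |\xi^+|>0\}$. Let $p_\xi(t)=\mathbf{P}^K_\xi(\xi(t)\in\mathcal{T}_K^{\mathrm{SWT}})$ and, for $0\le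 s\le K$, $p^{\mathrm{SWT}}_{K,s}(t)=\sup\{p_\xi(t):\xi\in\Gamma_K,\ S(\xi)=s\}$. *)

(* Defs.v *)
From HB Require Import structures.
From mathcomp Require Import all_boot all_order all_algebra.
From mathcomp Require Import all_classical all_reals all_analysis.

Set Implicit Arguments.
Unset Strict Implicit.
Unset Printing Implicit Defensive.

Import Order.TTheory GRing.Theory Num.Theory.
Import numFieldNormedType.Exports.

Local Open Scope classical_set_scope.
Local Open Scope ring_scope.

(* The ring T_K is 'I_K, with the cyclic successor and predecessor [ordS] and
   [ord_pred]. For K = 2 the two neighbours of a site coincide and such a jump
   has rate 2; for K = 1 there is no jump. *)

Definition occupation := {n : int | n <= 1}.

Definition Gamma (K : nat) := {ffun 'I_K -> occupation}.

Definition empty_site : occupation := exist _ (0 : int) isT.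

(* The configuration xi^{k,l}. When xi_l = 1 the value xi_l + 1 is not an
   occupation number and xi_l is left unchanged; the generator only uses the
   case xi_l <= 0. *)
Definition jump (K : nat) (xi : Gamma K) (k l : 'I_K) : Gamma K :=
  [ffun i => if i == k then empty_site
             else if i == l then insubd (xi l) (val (xi l) + 1)
             else xi i].

(* k + z, with z = 1 encoded as [true] and z = -1 as [false] *)
Definition neighbour (K : nat) (k : 'I_K) (z : bool) : 'I_K :=
  if z then ordS k else ord_pred k.

Definition generator (R : realType) (K : nat) (f : Gamma K -> R)
    (xi : Gamma K) : R :=
  \sum_(k < K) \sum_(z : bool)
    ((val (xi k) == 1) && (val (xi (neighbour k z)) <= 0))%:R
      * (f (jump xi k (neighbour k z)) - f xi).

Definition neg_part (K : nat) (xi : Gamma K) : int :=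
  - \sum_(k < K) Num.min (val (xi k)) 0.

Definition pos_part (K : nat) (xi : Gamma K) : int :=
  \sum_(k < K) (val (xi k) == 1)%:Z.

Definition excess (K : nat) (xi : Gamma K) : int := \sum_(k < K) val (xi k).

Definition transient (K : nat) : set (Gamma K) :=
  [set xi | 0 < neg_part xi /\ 0 < pos_part xi].

(* The family of sets generating the natural filtration at time t; Gamma K is
   countable and carries the discrete sigma-algebra. *)
Definition past_events (R : realType) (K : nat) (Omega : Type)
    (X : R -> Omega -> Gamma K) (t : R) : set (set Omega) :=
  [set E | exists u (B : set (Gamma K)), 0 <= u <= t /\ E = X u @^-1` B].

(* [P xi], xi in Gamma K, are the laws of a continuous-time Markov process
   X = (X t)_{t >= 0}, defined on a common space Omega, whose infinitesimal
   generator on the bounded functions (with the sup norm) is [generator].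
   Times are reals; nothing is required of [X t] for t < 0. *)
Record SWT_process (R : realType) (K : nat) (d : measure_display)
    (Omega : measurableType d) (X : R -> Omega -> Gamma K)
    (P : Gamma K -> probability Omega R) : Prop := {
  SWT_measurable : forall (t : R) (B : set (Gamma K)), 0 <= t ->
    measurable (X t @^-1` B);
  (* right-continuous paths with left limits, for the discrete topology *)
  SWT_right_continuous : forall (w : Omega) (t : R), 0 <= t ->
    \forall s \near t^'+, X s w = X t w;
  SWT_left_limits : forall (w : Omega) (t : R), 0 < t ->
    exists eta : Gamma K, \forall s \near t^'-, X s w = eta;
  SWT_start : forall xi : Gamma K, P xi (X 0 @^-1` [set xi]) = 1%E;
  (* P_xi (X (t + s) \in B | F_t) = P_{X t} (X s \in B) *)
  SWT_markov : forall (xi : Gamma K) (t s : R) (B : set (Gamma K))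
      (E : set Omega), 0 <= t -> 0 <= s -> <<s past_events X t >> E ->
    P xi (E `&` X (t + s) @^-1` B)
      = (\int[P xi]_(w in E) P (X t w) (X s @^-1` B))%E;
  SWT_generator : forall f : Gamma K -> R,
    (exists M : R, forall xi, `|f xi| <= M) ->
    forall e : R, 0 < e -> \forall t \near 0^'+, forall xi : Gamma K,
      `| (\int[P xi]_w f (X t w) - f xi) / t - generator f xi | <= e }.

Definition transience_prob (R : realType) (K : nat) (d : measure_display)
    (Omega : measurableType d) (X : R -> Omega -> Gamma K)
    (P : Gamma K -> probability Omega R) (xi : Gamma K) (t : R) : \bar R :=
  P xi (X t @^-1` @transient K).

Definition pSWT (R : realType) (K : nat) (d : measure_display)
    (Omega : measurableType d) (X : R -> Omega -> Gamma K)
    (P : Gamma K -> probability Omega R) (s : int) (t : R) : \bar R :=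
  ereal_sup [set transience_prob X P xi t | xi in [set xi | excess xi = s]].

(* Main.v *)
Require Import Defs.
From HB Require Import structures.
From mathcomp Require Import all_boot all_order all_algebra.
From mathcomp Require Import all_classical all_reals all_analysis.
From mathcomp Require Import ring lra zify.

Import Order.TTheory GRing.Theory Num.Theory.
Import numFieldNormedType.Exports.

Local Open Scope classical_set_scope.
Local Open Scope ring_scope.

(** Fix a site [x] carrying a trap. With [d] the distance from [x] to [k]
    measured around the ring in one direction, the potential
    [psi k = d (K - d)] has discrete Laplacian [-2] at every [k != x]. The
    current of the process across a bond is a discrete gradient,
    [eta_k - eta_(k+1)] with [eta_k] the indicator of a particle at [k]; hence,
    as long as the trap at [x] is not filled (so that [eta_x = 0]), the linear
    observable [F xi = \sum_k psi k * xi_k] has drift [-2] times the number of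
    particles. There are never fewer particles than the conserved excess [s],
    which is of order [delta K], so that [F] drifts down at rate of order
    [delta K], while a jump changes [F] by at most [K] and jumps occur at total
    rate at most [2 K].

    On configurations of excess [s], the exponential weight
    [w = 1_(xi_x < 0) exp (lam F)] with [lam] of order [delta / K^2] therefore
    satisfies [L w <= - beta w] with [beta] of order
    [delta^2 / K] ([generator_trap_weight]): the quadratic term
    [K (lam K)^2] of the exponential is dominated by the drift
    [lam delta K]. Since [|F| <= K^3], the weight lies between [exp (- lam K^3)]
    and [exp (lam K^3)] wherever it is positive, and both exponents are of order
    [delta K]. At a time [t = (8 / delta) K^2] the decay factor
    [exp (- beta t)] beats their ratio by a factor exponentially small in [K],
    which leaves room for a union bound over the [K] sites
    ([transience_bound]).

    The passage from the generator to the process is [expectation_decay]: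
    [L f <= - beta f] implies [E f (X_t) <= exp (- beta t) f]. It uses the
    Markov property over [n] time steps of length [t / n], the definition of
    the generator on each step, and [n -> oo]. *)

(** * Expectations of observables and exponential decay *)

Lemma Rintegral_sum_seq {R : realType} {d : measure_display}
    {T : measurableType d} (mu : {measure set T -> \bar R}) (I : Type)
    (r : seq I) (F : I -> T -> R) :
  (forall i, mu.-integrable setT (EFin \o F i)) ->
  \int[mu]_w (\sum_(i <- r) F i w) = \sum_(i <- r) \int[mu]_w F i w.
Proof.
move=> iF.
have iS s : mu.-integrable setT (EFin \o (fun w => \sum_(i <- s) F i w)).
  have -> : EFin \o (fun w => \sum_(i <- s) F i w)
      = (fun w => \sum_(i <- s) (F i w)%:E)%E.
    by apply/funext => w /=; rewrite sumEFin.
  by apply: integrable_sum => // i _; exact: iF.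
elim: r => [|i r IH].
  rewrite big_nil; under eq_Rintegral do rewrite big_nil.
  by rewrite /Rintegral integral0.
rewrite big_cons; under eq_Rintegral do rewrite big_cons.
by rewrite RintegralD ?IH//.
Qed.

Section Process.
Context {R : realType} {K : nat} {d : measure_display}
  {Omega : measurableType d} {X : R -> Omega -> Gamma K}
  {P : Gamma K -> probability Omega R}.
Context (XP : SWT_process X P).

Lemma measurable_event {t : R} (t0 : 0 <= t) (B : set (Gamma K)) :
  measurable (X t @^-1` B).
Proof. exact: (SWT_measurable XP B t0). Qed.

Lemma measurable_observable {t : R} (t0 : 0 <= t) (g : Gamma K -> R) :
  measurable_fun setT (fun w => g (X t w)).
Proof.
move=> _ B _; rewrite setTI.
exact: (measurable_event t0 (g @^-1` B)).
Qed.

Lemma integrable_observable {t : R} (t0 : 0 <= t) (xi : Gamma K)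
    {g : Gamma K -> R} :
  (exists M : R, forall eta, `|g eta| <= M) ->
  (P xi).-integrable setT (EFin \o (fun w => g (X t w))).
Proof.
move=> [M gM]; apply: measurable_bounded_integrable => //.
- by rewrite /= probability_setT ltry.
- exact: measurable_observable.
- exists M; split; first exact: num_real.
  by move=> N MN w _ /=; exact: le_trans (gM _) (ltW MN).
Qed.

Lemma expectation_affine {t : R} (t0 : 0 <= t) (xi : Gamma K)
    {f : Gamma K -> R} (a b : R) :
  (exists M : R, forall eta, `|f eta| <= M) ->
  \int[P xi]_w (a * f (X t w) + b) = a * (\int[P xi]_w f (X t w)) + b.
Proof.
move=> fb; have iF := integrable_observable t0 xi fb.
rewrite RintegralD ?RintegralZl ?Rintegral_cst //.
- by have /= -> := @probability_setT _ _ _ (P xi); rewrite mulr1.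
- have [M fM] := fb.
  apply: (integrable_observable t0 xi (g := fun eta => a * f eta)).
  by exists (`|a| * M) => eta; rewrite normrM ler_wpM2l.
- exact: finite_measure_integrable_cst.
Qed.

Lemma le_expectation {t : R} (t0 : 0 <= t) (xi : Gamma K)
    {f g : Gamma K -> R} :
  (exists M : R, forall eta, `|f eta| <= M) ->
  (exists M : R, forall eta, `|g eta| <= M) ->
  (forall eta, f eta <= g eta) ->
  \int[P xi]_w f (X t w) <= \int[P xi]_w g (X t w).
Proof.
move=> fb gb fg; apply: le_Rintegral => //.
- exact: integrable_observable.
- exact: integrable_observable.
Qed.

Lemma bounded_expectation {t : R} (t0 : 0 <= t) {f : Gamma K -> R} :
  (exists M : R, forall eta, `|f eta| <= M) ->
  exists M : R, forall eta, `|\int[P eta]_w f (X t w)| <= M.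
Proof.
move=> fb; have [M fM] := fb; exists M => xi.
have cM c : exists M', forall eta : Gamma K, `|0 * f eta + c| <= M'.
  by exists `|c| => eta; rewrite mul0r add0r.
have := le_expectation t0 xi fb (cM M) _.
have := le_expectation t0 xi (cM (- M)) fb _.
rewrite !(expectation_affine t0 xi _ _ fb) !mul0r !add0r => L U.
by rewrite ler_norml L ?U // => eta; have := fM eta;
  rewrite ler_norml mul0r add0r => /andP[].
Qed.

Lemma finite_range_bounded {r : seq R} {f : Gamma K -> R} :
  (forall eta, f eta \in r) -> exists M : R, forall eta, `|f eta| <= M.
Proof.
move=> fr; exists (\sum_(v <- undup r) `|v|) => eta.
rewrite (bigD1_seq (f eta)) ?mem_undup ?undup_uniq //=.
by rewrite lerDl sumr_ge0.
Qed.

Lemma finite_range_indic {r : seq R} {f : Gamma K -> R} :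
  (forall eta, f eta \in r) -> forall eta,
  f eta = \sum_(v <- undup r) v * (f eta == v)%:R.
Proof.
move=> fr eta.
rewrite (bigD1_seq (f eta)) ?mem_undup ?undup_uniq //= eqxx mulr1.
by rewrite big1 ?addr0// => v /negbTE; rewrite eq_sym => ->; rewrite mulr0.
Qed.

Lemma Rintegral_level {t : R} (t0 : 0 <= t) (xi : Gamma K)
    (f : Gamma K -> R) (v : R) :
  \int[P xi]_w (f (X t w) == v)%:R = fine (P xi (X t @^-1` (f @^-1` [set v]))).
Proof.
rewrite /Rintegral -[in RHS](setIT (X t @^-1` _)) -integral_indic//; last first.
  exact: measurable_event.
congr fine; apply: eq_integral => w _; rewrite indicE.
congr (nat_of_bool _)%:R%:E.
by apply/eqP/idP; rewrite inE.
Qed.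

Lemma Rintegral_finite_range {r : seq R} {f : Gamma K -> R} {t : R}
    (t0 : 0 <= t) (xi : Gamma K) : (forall eta, f eta \in r) ->
  \int[P xi]_w f (X t w) =
  \sum_(v <- undup r) v * fine (P xi (X t @^-1` (f @^-1` [set v]))).
Proof.
move=> fr.
under eq_Rintegral do rewrite (finite_range_indic fr).
have i1 v : (P xi).-integrable setT (EFin \o (fun w => (f (X t w) == v)%:R)).
  apply: (integrable_observable t0 xi (g := fun eta => (f eta == v)%:R)).
  by exists 1 => eta; case: (f eta == v); rewrite ?normr1 ?normr0 // ler01.
rewrite Rintegral_sum_seq => [|v]; last first.
  apply: (integrable_observable t0 xi (g := fun eta => v * (f eta == v)%:R)).
  exists `|v| => eta; case: (f eta == v).
    by rewrite mulr1.
  by rewrite mulr0 normr0.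
by apply: eq_bigr => v _; rewrite RintegralZl // Rintegral_level.
Qed.

(** Decomposing [f] along its finitely many level sets reduces the claim to the
    Markov property of events; the observables used below all have finite
    range. *)
Lemma markov_observable {r : seq R} {f : Gamma K -> R} {t s : R} (xi : Gamma K) :
  (forall eta, f eta \in r) -> 0 <= t -> 0 <= s ->
  \int[P xi]_w f (X (t + s) w)
  = \int[P xi]_w \int[P (X t w)]_v f (X s v).
Proof.
move=> fr t0 s0; have ts0 : 0 <= t + s by exact: addr_ge0.
under [RHS]eq_Rintegral do rewrite (Rintegral_finite_range s0 _ fr).
have fp (eta : Gamma K) (B : set (Gamma K)) u : 0 <= u ->
    0 <= fine (P eta (X u @^-1` B)) <= 1.
  move=> u0; rewrite fine_ge0 ?measure_ge0 //= -lee_fin fineK.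
    by apply: probability_le1; exact: measurable_event.
  by apply: fin_num_measure; exact: measurable_event.
pose g v eta := fine (P eta (X s @^-1` (f @^-1` [set v]))).
have ig v : (P xi).-integrable setT (EFin \o (fun w => g v (X t w))).
  apply: (integrable_observable t0 xi (g := g v)).
  exists 1 => eta; have /andP[g0 g1] := fp eta (f @^-1` [set v]) s s0.
  by rewrite ger0_norm.
rewrite Rintegral_sum_seq => [|v]; last first.
  apply: (integrable_observable t0 xi (g := fun eta => v * g v eta)).
  exists `|v| => eta; have /andP[g0 g1] := fp eta (f @^-1` [set v]) s s0.
  by rewrite normrM ler_piMr // ger0_norm.
rewrite (Rintegral_finite_range ts0 _ fr); apply: eq_bigr => v _.
rewrite (RintegralZl v measurableT (ig v)); congr (_ * _).
have := SWT_markov XP xi (f @^-1` [set v]) t0 s0 (E := setT).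
rewrite setTI => ->; last first.
  have [S0 SC _] := smallest_sigma_algebra setT (past_events X t).
  by have := SC _ S0; rewrite setD0.
congr fine; apply: eq_integral => w _ /=.
by rewrite /g fineK //; apply: fin_num_measure; exact: measurable_event.
Qed.

(** On a step of length [h = t / n] the generator condition gives
    [E f (X_h) <= (1 - beta h) f + h e'] uniformly in the starting point, for
    any [e' > 0] once [n] is large; iterating with the Markov property, the
    errors add up to at most [t e'], and [(1 - beta h)^n <= exp (- beta t)]. *)
Lemma expectation_decay {r : seq R} {f : Gamma K -> R} {beta : R} :
  (forall eta, f eta \in r) -> 0 <= beta ->
  (forall eta, generator f eta <= - beta * f eta) -> (forall eta, 0 <= f eta) ->
  forall (xi : Gamma K) (t : R), 0 < t ->
  \int[P xi]_w f (X t w) <= expR (- (beta * t)) * f xi.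
Proof.
move=> fr beta0 Lf f0 xi t t0.
have fb := finite_range_bounded fr.
apply/ler_addgt0Pr => e e0.
have e't : 0 < e / t by rewrite divr_gt0.
have [eps /= eps0 Heps] := SWT_generator XP fb e't.
(* [n.+1 > t / eps] makes the step short enough for the generator condition,
   and [n.+1 > beta t] makes [1 - beta h] nonnegative. *)
pose c := Num.max (t / eps) (beta * t).
have [n nc] : exists n : nat, c < n.+1%:R.
  exists (Num.trunc c); exact: truncnS_gt.
pose h := t / n.+1%:R.
have n0 : 0 < n.+1%:R :> R by rewrite ltr0n.
have h0 : 0 < h by rewrite divr_gt0.
have heps : h < eps.
  rewrite ltr_pdivrMr // mulrC -ltr_pdivrMr //.
  by apply: le_lt_trans nc; rewrite le_max lexx.
have bh1 : beta * h <= 1.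
  rewrite mulrA ler_pdivrMr // mul1r.
  by apply: le_trans (ltW nc); rewrite le_max lexx orbT.
have step eta : \int[P eta]_w f (X h w) <= (1 - beta * h) * f eta + h * (e / t).
  have := Heps h; rewrite /= sub0r normrN (gtr0_norm h0) => /(_ heps h0 eta).
  move=> /(le_trans (ler_norm _)); rewrite lerBlDr ler_pdivrMr // => H.
  have := Lf eta; nra.
have iter j : \int[P xi]_w f (X (j.+1%:R * h) w)
    <= (1 - beta * h) ^+ j.+1 * f xi + j.+1%:R * (h * (e / t)).
  elim: j => [|j IH]; first by rewrite !mul1r expr1 step.
  have jh : 0 <= j.+1%:R * h by rewrite mulr_ge0 // ltW.
  rewrite -(natr1 j.+1) ![(_ + 1) * _]mulrDl !mul1r.
  rewrite (markov_observable xi fr jh (ltW h0)).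
  apply: (@le_trans _ _ (\int[P xi]_w ((1 - beta * h) * f (X (j.+1%:R * h) w)
       + h * (e / t)))).
    apply: (le_expectation jh xi
      (f := fun eta => \int[P eta]_v f (X h v))
      (g := fun eta => (1 - beta * h) * f eta + h * (e / t))) => //.
      exact (bounded_expectation (ltW h0) fb).
    have [M fM] := fb.
    exists (`|1 - beta * h| * M + `|h * (e / t)|) => eta.
    by apply: le_trans (ler_normD _ _) _; rewrite lerD2r normrM ler_wpM2l.
  rewrite (expectation_affine jh xi _ _ fb) addrA lerD2r.
  apply: le_trans (ler_wpM2l _ IH) _; first by rewrite subr_ge0.
  rewrite mulrDr (mulrA _ _ (f xi)) -exprS lerD2l ler_piMl //; last first.
    by rewrite gerBl mulr_ge0 // ltW.
  by rewrite mulr_ge0 // mulr_ge0 // ltW.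
have th : n.+1%:R * h = t by rewrite mulrC divfK // gt_eqF.
have := iter n; rewrite th => H; apply: le_trans H _; apply: lerD; last first.
  by rewrite mulrA th mulrC divfK // gt_eqF.
apply: ler_wpM2r => //.
have -> : - (beta * t) = n.+1%:R * - (beta * h) by rewrite -th mulrN mulrCA.
rewrite expRM_natl; apply: lerXn2r.
- by rewrite nnegrE subr_ge0.
- by rewrite nnegrE expR_ge0.
- exact: expR_ge1Dx.
Qed.

(** Markov's inequality applied to [expectation_decay]. *)
Lemma probability_decay {r : seq R} {f : Gamma K -> R} {beta c : R}
    (B : set (Gamma K)) :
  (forall eta, f eta \in r) -> 0 <= beta ->
  (forall eta, generator f eta <= - beta * f eta) -> (forall eta, 0 <= f eta) ->
  (forall eta, B eta -> c <= f eta) -> 0 < c ->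
  forall (xi : Gamma K) (t : R), 0 < t ->
  (P xi (X t @^-1` B) <= (c^-1 * expR (- (beta * t)) * f xi)%:E)%E.
Proof.
move=> fr beta0 Lf f0 cB c0 xi t t0.
have mB := measurable_event (ltW t0) B.
rewrite -mulrA -[leLHS]fineK ?fin_num_measure // lee_fin.
rewrite mulrC ler_pdivlMr //.
apply: le_trans (expectation_decay fr beta0 Lf f0 xi t t0).
have ib : exists M : R, forall eta : Gamma K, `|\1_B eta : R| <= M.
  by exists 1 => eta; rewrite indicE; case: (_ \in _); rewrite ?normr1 ?normr0.
have -> : fine (P xi (X t @^-1` B)) * c = \int[P xi]_w (c * \1_B (X t w) + 0).
  rewrite (expectation_affine (ltW t0) xi _ _ ib) addr0 mulrC; congr (_ * _).
  rewrite /Rintegral -[in LHS](setIT (X t @^-1` _)) -integral_indic//.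
apply: (le_expectation (ltW t0) xi (f := fun eta => c * \1_B eta + 0)).
- have [M iM] := ib; exists (`|c| * M) => eta.
  by rewrite addr0 normrM ler_wpM2l.
- exact: finite_range_bounded fr.
- move=> eta; rewrite addr0 indicE; case: (boolP (_ \in _)) => [|_].
    by rewrite inE mulr1 => /cB.
  by rewrite mulr0.
Qed.

End Process.

(** * Jumps and conserved quantities *)

(** The occupation number as an [int], so that the order and the arithmetic on
    it are those of [int] syntactically. *)
Definition height {K : nat} (xi : Gamma K) (k : 'I_K) : int := val (xi k).

Definition linear_observable {K : nat} (c : 'I_K -> int) (xi : Gamma K) : int :=
  \sum_(k < K) c k * height xi k.

Lemma height_le1 {K : nat} (xi : Gamma K) k : height xi k <= 1.
Proof. exact: (valP (xi k)). Qed.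

Lemma particleE {K : nat} (xi : Gamma K) k :
  (height xi k <= 0) = ~~ (height xi k == 1).
Proof. have := height_le1 xi k; lia. Qed.

Lemma jump_site {K : nat} (xi : Gamma K) (k l i : 'I_K) :
  height xi k = 1 -> height xi l <= 0 ->
  height (jump xi k l) i = height xi i + (i == l)%:Z - (i == k)%:Z.
Proof.
move=> xk xl; rewrite {1}/height ffunE; have [->|ik] := eqVneq i k.
  have -> : (k == l) = false.
    by apply/negbTE/eqP => kl; rewrite -kl xk in xl.
  by rewrite xk.
have [->|il] := eqVneq i l; last by rewrite addr0 subr0.
by rewrite subr0 insubdK // /in_mem /= -/(height xi l); lia.
Qed.

Lemma linear_observable_jump {K : nat} (c : 'I_K -> int) (xi : Gamma K)
    (k l : 'I_K) :
  height xi k = 1 -> height xi l <= 0 ->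
  linear_observable c (jump xi k l) = linear_observable c xi + (c l - c k).
Proof.
move=> xk xl; rewrite /linear_observable.
under eq_bigr do rewrite (jump_site _ _ _ _ xk xl) mulrBr mulrDr.
have delta j : \sum_(i < K) c i * (i == j)%:Z = c j.
  rewrite (bigD1 j) //= eqxx mulr1 big1 ?addr0 // => i /negbTE ->.
  by rewrite mulr0.
by rewrite sumrB big_split /= !delta -addrA.
Qed.

Lemma excessE {K : nat} (xi : Gamma K) :
  excess xi = linear_observable (fun=> 1) xi.
Proof. by apply: eq_bigr => k _; rewrite mul1r. Qed.

Lemma excess_jump {K : nat} (xi : Gamma K) (k l : 'I_K) :
  height xi k = 1 -> height xi l <= 0 -> excess (jump xi k l) = excess xi.
Proof.
by move=> xk xl; rewrite !excessE linear_observable_jump // subrr addr0.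
Qed.

Lemma excess_le_pos_part {K : nat} (xi : Gamma K) : excess xi <= pos_part xi.
Proof.
apply: ler_sum => k _; rewrite -!/(height xi k).
by have := height_le1 xi k; case: eqP; lia.
Qed.

Lemma generator_excess {R : realType} {K : nat} (s : int) (xi : Gamma K) :
  generator (fun eta => (excess eta != s)%:R : R) xi = 0.
Proof.
rewrite /generator big1 // => k _; rewrite big1 // => z _.
case: andP => [[/eqP xk xl]|_]; last by rewrite mul0r.
by rewrite excess_jump // subrr mulr0.
Qed.

(** The lower bound uses [c k * xi_k >= m * xi_k - m], which holds because
    [1 - xi_k >= 0], and the sign of the total excess. *)
Lemma linear_observable_bound {K : nat} (c : 'I_K -> int) (m : int)
    (xi : Gamma K) :
  (forall k, 0 <= c k <= m) -> 0 <= excess xi ->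
  `|linear_observable c xi| <= m * K%:Z.
Proof.
move=> cm s0; rewrite ler_norml; apply/andP; split.
  apply: (@le_trans _ _ (\sum_(k < K) (m * height xi k - m))).
    rewrite sumrB -mulr_sumr -/(excess xi) sumr_const card_ord.
    rewrite -mulr_natr natz.
    case: K => [|K] in c xi cm s0 *; first by rewrite /excess big_ord0 !mulr0.
    have := cm ord0; nia.
  apply: ler_sum => k _; have := height_le1 xi k; have := cm k; nia.
apply: (@le_trans _ _ (\sum_(k < K) m)).
  apply: ler_sum => k _; have := height_le1 xi k; have := cm k; nia.
by rewrite sumr_const card_ord -mulr_natr natz.
Qed.

Lemma transient_trap {K : nat} (xi : Gamma K) :
  transient xi -> exists x : 'I_K, height xi x < 0.
Proof.
move=> [n0 _]; apply: contrapT => H; move: n0; rewrite /neg_part.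
rewrite big1 ?oppr0 // => k _; apply: min_r.
by rewrite leNgt; apply/negP => xk; apply: H; exists k.
Qed.

(** Without such a configuration the supremum of the transience probabilities
    would be [-oo]. *)
Lemma exists_excess {K : nat} (s : int) : 0 <= s <= K%:Z ->
  exists xi : Gamma K, excess xi = s.
Proof.
case: s => // n /= nK.
exists [ffun k : 'I_K => insubd empty_site ((k < n)%N : int)].
rewrite /excess; under eq_bigr => k _.
  rewrite ffunE insubdK; last by rewrite /in_mem /=; case: (k < n)%N.
  over.
rewrite -(big_mkord xpredT (fun k => ((k < n)%N : int))) /=.
rewrite (big_cat_nat (n := n)) //= big_nat.
under eq_bigr => k /andP[_ ->] do [].
rewrite -big_nat sumr_const_nat subn0 big_nat.
rewrite big1 ?addr0 ?natz // => k /andP[nk _]; by rewrite ltnNge nk.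
Qed.

(** * The potential around a trap *)

(** Distance from [x] to [k] in the direction of [ordS]. *)
Definition cyclic_dist {K : nat} (x k : 'I_K) : nat := (k + (K - x)) %% K.

Lemma cyclic_dist_ordS {K : nat} (x k : 'I_K) :
  cyclic_dist x (ordS k) = ((cyclic_dist x k).+1 %% K)%N.
Proof.
by rewrite /cyclic_dist /= modnDml -addn1 -addnA (addnC 1) addnA -modnDml addn1.
Qed.

Lemma cyclic_dist_lt {K : nat} (x k : 'I_K) : (cyclic_dist x k < K)%N.
Proof. by rewrite ltn_pmod // (leq_ltn_trans _ (ltn_ord k)). Qed.

Lemma cyclic_dist_eq0 {K : nat} {x k : 'I_K} : cyclic_dist x k = 0%N -> k = x.
Proof.
have [kK xK] := (ltn_ord k, ltn_ord x); move/eqP => /dvdnP[q qK].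
apply/val_inj => /=; case: q => [|[|q]] in qK *; nia.
Qed.

(** Up to an affine change, the Green function of the ring with pole [x]. *)
Definition potential {K : nat} (x k : 'I_K) : int :=
  (cyclic_dist x k)%:Z * (K%:Z - (cyclic_dist x k)%:Z).

Lemma potential_bound {K : nat} (x k : 'I_K) :
  0 <= potential x k <= K%:Z ^+ 2.
Proof. by have := cyclic_dist_lt x k; rewrite /potential; nia. Qed.

(** At the last site before [x] the distance wraps from [K - 1] to [0]; the
    formula survives because [d (K - d)] vanishes at both [d = 0] and
    [d = K]. *)
Lemma potential_ordS {K : nat} (x k : 'I_K) :
  potential x (ordS k)
  = (cyclic_dist x k).+1%:Z * (K%:Z - (cyclic_dist x k).+1%:Z).
Proof.
rewrite /potential cyclic_dist_ordS.
have := cyclic_dist_lt x k; rewrite leq_eqVlt => /orP[/eqP ->|lt].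
  by rewrite modnn subrr mul0r mulr0.
by rewrite modn_small.
Qed.

Lemma potential_gradient {K : nat} (x k : 'I_K) :
  `|potential x (ordS k) - potential x k| <= K%:Z.
Proof.
have := cyclic_dist_lt x k; rewrite potential_ordS /potential; nia.
Qed.

Lemma potential_laplacian {K : nat} (x k : 'I_K) : k != x ->
  (potential x (ordS k) - potential x k)
  + (potential x (ord_pred k) - potential x k) = - 2.
Proof.
move=> kx; rewrite -{1 2 4}(ord_predK k); set j := ord_pred k.
have jx : ((cyclic_dist x j).+1 < K)%N.
  have := cyclic_dist_lt x j; rewrite leq_eqVlt => /orP[/eqP e|//].
  case/negP: kx; apply/eqP/cyclic_dist_eq0.
  by rewrite -(ord_predK k) cyclic_dist_ordS e modnn.
rewrite (potential_ordS x (ordS j)) (potential_ordS x j) cyclic_dist_ordS.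
by rewrite modn_small // /potential; lia.
Qed.

(** The exclusion rule makes the jump rate [eta_k - eta_k * eta_l], and the
    quadratic part cancels between the two orientations of each bond: the
    drift is the Laplacian of [c] summed over the particles. *)
Lemma particle_drift {K : nat} (c : 'I_K -> int) (xi : Gamma K) :
  \sum_(k < K) \sum_(z : bool)
    ((height xi k == 1) && (height xi (neighbour k z) <= 0))%:Z
      * (c (neighbour k z) - c k)
  = \sum_(k < K) (height xi k == 1)%:Z
      * ((c (ordS k) - c k) + (c (ord_pred k) - c k)).
Proof.
pose eta k : int := (height xi k == 1)%:Z.
have rate k l : ((height xi k == 1) && (height xi l <= 0))%:Z
    = eta k - eta k * eta l.
  by rewrite particleE /eta; do 2 case: (_ == _).
have sum2 (F : bool -> int) : \sum_(z : bool) F z = F true + F false.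
  by rewrite (bigD1 true) //= (bigD1 false) //= big1 ?addr0 // => -[].
pose G k := eta k * eta (ordS k) * (c (ordS k) - c k).
pose H k := eta k * eta (ord_pred k) * (c (ord_pred k) - c k).
have GH : \sum_k G k + \sum_k H k = 0.
  rewrite [X in _ + X](reindex_inj (can_inj (@ordSK K))) /=.
  rewrite -big_split /= big1 // => k _.
  by rewrite /G /H ordSK; ring.
transitivity (\sum_(k < K) eta k * ((c (ordS k) - c k) + (c (ord_pred k) - c k))
    - (\sum_k G k + \sum_k H k)); last by rewrite GH subr0.
rewrite -big_split -sumrB; apply: eq_bigr => k _.
by rewrite sum2 /= !rate /G /H /eta; ring.
Qed.

(** Invert [1 - u <= exp (- u)], and use [1 / (1 - u) = 1 + u + u^2 / (1 - u)]
    with [1 - u >= 1 / 2]. *)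
Lemma expR_quadratic {R : realType} (u : R) :
  `|u| <= 2^-1 -> expR u <= 1 + u + 2 * u ^+ 2.
Proof.
rewrite ler_norml => /andP[u1 u2].
have v0 : 0 < 1 - u by lra.
have : expR u <= (1 - u)^-1.
  rewrite -[u in leLHS]opprK expRN lef_pV2 ?posrE ?expR_gt0 //.
  exact: expR_ge1Dx.
move=> /le_trans; apply; rewrite -[leLHS]mul1r ler_pdivrMr //.
have : 0 <= u ^+ 2 * (1 - 2 * u) by rewrite mulr_ge0 ?sqr_ge0 //; lra.
nra.
Qed.

(** * The exponential weight of an unfilled trap *)

(** The restriction to excess [s] makes the weight bounded, with finite
    range. *)
Definition trap_weight {R : realType} {K : nat} (s : int) (lam : R)
    (x : 'I_K) (xi : Gamma K) : R :=
  ((excess xi == s) && (height xi x < 0))%:R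
    * expR (lam * (linear_observable (potential x) xi)%:~R).

(** A jump never digs a trap, so the indicator in the weight can only drop; the
    exponential changes by the factor [exp (lam (psi l - psi k))], expanded to
    second order with [expR_quadratic]. *)
Lemma jump_trap_weight {R : realType} {K : nat} (s : int) (lam : R)
    (x k l : 'I_K) (xi : Gamma K) :
  height xi k = 1 -> height xi l <= 0 ->
  0 <= lam -> lam * K%:R <= 2^-1 ->
  `|potential x l - potential x k| <= K%:Z ->
  trap_weight s lam x (jump xi k l) - trap_weight s lam x xi
  <= trap_weight s lam x xi
     * (lam * (potential x l - potential x k)%:~R + 2 * (lam * K%:R) ^+ 2).
Proof.
move=> xk xl lam0 lamK grad; set D := potential x l - _.
rewrite /trap_weight excess_jump // linear_observable_jump // -/D.
set u := lam * D%:~R.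
have uK : `|u| <= lam * K%:R.
  rewrite normrM ger0_norm // ler_wpM2l //.
  by move: grad; rewrite -(ler_int R) intr_norm.
have eu : expR u <= 1 + (u + 2 * (lam * K%:R) ^+ 2).
  rewrite addrA; apply: le_trans (expR_quadratic _ (le_trans uK lamK)) _.
  rewrite lerD2l ler_pM2l // -real_normK ?num_real //.
  by rewrite lerXn2r ?nnegrE // mulr_ge0.
have up : 0 <= expR u by exact: expR_ge0.
rewrite intrD mulrDr expRD -/u.
set e := expR (_ * _); have e0 : 0 <= e by exact: expR_ge0.
have [/andP[_ xx]|] := boolP ((excess xi == s) && (height xi x < 0)); last first.
  rewrite negb_and => /orP H.
  have -> : (excess xi == s) && (height (jump xi k l) x < 0) = false.
    case: H => [/negbTE -> //|xx].
    rewrite jump_site //; have [xek|] := eqVneq x k.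
      by rewrite xek xk; case: (k == l); rewrite andbC.
    by move=> _; apply/negbTE; rewrite negb_and; case: (x == l); lia.
  by rewrite !mul0r subrr.
apply: (@le_trans _ _ (e * expR u - e)).
  rewrite mul1r lerD2r ler_piMl ?mulr_ge0 //.
  by case: (_ && _); rewrite ?ler01.
by rewrite mul1r -[X in _ - X]mulr1 -mulrBr ler_wpM2l // lerBlDl.
Qed.

(** The linear terms give the drift of [particle_drift]: where the weight is
    nonzero there is no particle at [x], so [potential_laplacian] applies to
    every particle, and there are at least [s] of them. The second-order terms
    are bounded over all [2 K] possible jumps. *)
Lemma generator_trap_weight {R : realType} {K : nat} (s : int) (lam : R)
    (x : 'I_K) (xi : Gamma K) :
  0 <= lam -> lam * K%:R <= 2^-1 ->
  generator (trap_weight s lam x) xi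
  <= - (2 * lam * s%:~R - 4 * K%:R * (lam * K%:R) ^+ 2)
     * trap_weight s lam x xi.
Proof.
move=> lam0 lamK; set w := trap_weight s lam x; set q := (lam * K%:R) ^+ 2.
have w0 : 0 <= w xi by rewrite mulr_ge0 // expR_ge0.
pose rate k z := (height xi k == 1) && (height xi (neighbour k z) <= 0).
pose D k z : int := potential x (neighbour k z) - potential x k.
have grad k z : `|D k z| <= K%:Z.
  rewrite /D; case: z; first exact: potential_gradient.
  by rewrite distrC -{1}(ord_predK k) potential_gradient.
have q0 : 0 <= 2 * q by rewrite mulr_ge0 ?sqr_ge0.
apply: (@le_trans _ _ (\sum_(k < K) \sum_(z : bool)
    (w xi * lam * ((rate k z)%:Z * D k z)%:~R + w xi * (2 * q)))).
  apply: ler_sum => k _; apply: ler_sum => z _; rewrite -!/(height _ _).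
  rewrite -/(rate k z); have [/andP[/eqP xk xl]|_] := boolP (rate k z).
    rewrite !mul1r -mulrA -mulrDr.
    exact: jump_trap_weight (grad k z).
  by rewrite !mul0r mulr0 add0r mulr_ge0.
have -> : \sum_(k < K) \sum_(z : bool)
    (w xi * lam * ((rate k z)%:Z * D k z)%:~R + w xi * (2 * q))
  = w xi * lam * (\sum_(k < K) \sum_(z : bool) (rate k z)%:Z * D k z)%:~R
    + w xi * (4 * K%:R * q).
  have inner k : \sum_(z : bool)
      (w xi * lam * ((rate k z)%:Z * D k z)%:~R + w xi * (2 * q))
    = w xi * lam * (\sum_(z : bool) (rate k z)%:Z * D k z)%:~R
      + w xi * (4 * q).
    rewrite big_split /= sumr_const card_bool rmorph_sum mulr_sumr.
    by congr (_ + _); ring.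
  rewrite (eq_bigr _ (fun k _ => inner k)) big_split /= sumr_const card_ord.
  by rewrite rmorph_sum mulr_sumr -mulr_natl; congr (_ + _); ring.
rewrite particle_drift.
have [xx|] := boolP ((excess xi == s) && (height xi x < 0)); last first.
  by rewrite /w /trap_weight => /negbTE ->; rewrite !(mul0r, mulr0) addr0.
have {xx} [/eqP es xx] := andP xx.
have -> : \sum_(k < K) (height xi k == 1)%:Z
      * ((potential x (ordS k) - potential x k)
         + (potential x (ord_pred k) - potential x k)) = - 2 * pos_part xi.
  rewrite mulr_sumr; apply: eq_bigr => k _; rewrite -/(height xi k).
  have [xk|_] := eqVneq (height xi k) 1; last by rewrite mul0r mulr0.
  rewrite potential_laplacian ?mul1r ?mulr1 //.
  by apply/eqP => kx; rewrite -kx xk in xx.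
have sp : (s%:~R : R) <= (pos_part xi)%:~R.
  by rewrite ler_int -es excess_le_pos_part.
have wl : 0 <= w xi * lam by rewrite mulr_ge0.
rewrite intrM; nra.
Qed.

(** * Filling all the traps *)

Lemma potential_observable_bound {K : nat} (x : 'I_K) (xi : Gamma K) :
  0 <= excess xi -> `|linear_observable (potential x) xi| <= (K ^ 3)%N%:Z.
Proof.
move=> s0; apply: le_trans (linear_observable_bound _ _ _ (potential_bound x) s0) _.
by rewrite -exprSr -(natz (K ^ 3)) natrX natz.
Qed.

Lemma trap_weight_range {R : realType} {K : nat} (s : int) (lam : R)
    (x : 'I_K) (eta : Gamma K) : 0 <= s ->
  trap_weight s lam x eta \in
    0 :: [seq expR (lam * (i%:R - (K ^ 3)%:R)) | i <- iota 0 (2 * K ^ 3).+1].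
Proof.
move=> s0; rewrite /trap_weight.
have [/andP[/eqP es _]|_] := boolP (_ && _); last by rewrite mul0r mem_head.
rewrite mul1r in_cons; apply/orP; right.
have := potential_observable_bound x eta; rewrite es => /(_ s0).
set F := linear_observable _ _ => FK; set N := (K ^ 3)%N in FK *.
apply/mapP; exists (absz (F + N%:Z)); first by rewrite mem_iota; lia.
congr (expR (lam * _)).
have -> : F = (absz (F + N%:Z))%:Z - N%:Z by lia.
by rewrite intrB; congr (_%:R - _); lia.
Qed.

Section Survival.
Context {R : realType} {K : nat} {d : measure_display}
  {Omega : measurableType d} {X : R -> Omega -> Gamma K}
  {P : Gamma K -> probability Omega R}.
Context (XP : SWT_process X P).

Lemma excess_conserved (xi : Gamma K) (t : R) : 0 < t ->
  P xi (X t @^-1` [set eta | excess eta != excess xi]) = 0%E.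
Proof.
move=> t0; apply/eqP; rewrite -measure_le0.
pose f (eta : Gamma K) : R := (excess eta != excess xi)%:R.
apply: le_trans (probability_decay XP (r := [:: 0; 1]) (f := f) (beta := 0)
  (c := 1) _ _ _ _ _ _ _ _ _ t0) _ => //.
- by move=> eta; rewrite /f; case: (_ != _); rewrite !inE eqxx ?orbT.
- by move=> eta; rewrite generator_excess oppr0 mul0r.
- by move=> eta /= h; rewrite /f h.
- by rewrite /f eqxx mulr0.
Qed.

(** [probability_decay] for the weight; [exp (2 lam K^3)] bounds the ratio of
    the largest to the smallest positive value of the weight. *)
Lemma trap_survival (s : int) (lam beta : R) (x : 'I_K) (xi : Gamma K) (t : R) :
  0 <= s -> 0 <= lam -> lam * K%:R <= 2^-1 ->
  0 <= beta <= 2 * lam * s%:~R - 4 * K%:R * (lam * K%:R) ^+ 2 ->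
  excess xi = s -> 0 < t ->
  (P xi (X t @^-1` [set eta | (excess eta == s) && (height eta x < 0)%R])
   <= (expR (2 * (lam * K%:R ^+ 3) - beta * t))%:E)%E.
Proof.
move=> s0 lam0 lamK /andP[beta0 betale] es t0.
pose f : Gamma K -> R := trap_weight s lam x.
have f0 eta : 0 <= f eta by rewrite mulr_ge0 // expR_ge0.
have FK eta : excess eta = s ->
    `|(linear_observable (potential x) eta)%:~R| <= K%:R ^+ 3 :> R.
  move=> ee; rewrite -intr_norm -natrX.
  have := potential_observable_bound x eta; rewrite ee => /(_ s0).
  by rewrite -(ler_int R).
apply: le_trans (probability_decay XP (f := f) (beta := beta)
  (c := expR (- (lam * K%:R ^+ 3))) _
  (fun eta => trap_weight_range _ _ _ _ s0) beta0 _ f0 _ _ _ _ t0) _.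
- move=> eta; apply: le_trans (generator_trap_weight _ _ _ _ lam0 lamK) _.
  by rewrite ler_wpM2r // lerN2.
- move=> eta /= H; rewrite /f /trap_weight H mul1r ler_expR.
  have /andP[/eqP /FK + _] := H; rewrite ler_norml => /andP[H1 _].
  by rewrite -mulrN ler_wpM2l.
- exact: expR_gt0.
rewrite lee_fin -expRN opprK.
have -> : 2 * (lam * K%:R ^+ 3) - beta * t
    = lam * K%:R ^+ 3 + - (beta * t) + lam * K%:R ^+ 3 by ring.
rewrite !expRD ler_wpM2l ?mulr_ge0 ?expR_ge0 //.
rewrite /f /trap_weight; apply: (@le_trans _ _ (1 * expR (lam * K%:R ^+ 3))).
  apply: ler_pM => //; rewrite ?expR_ge0 //.
    by case: (_ && _); rewrite ?ler01.
  rewrite ler_expR ler_wpM2l //.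
  by have := FK _ es; rewrite ler_norml => /andP[].
by rewrite mul1r.
Qed.

(** A transient configuration has an unfilled trap at some site: a union bound
    over the sites, on the almost sure event that the excess is conserved. *)
Lemma transience_bound (s : int) (lam beta : R) (xi : Gamma K) (t : R) :
  0 <= s -> 0 <= lam -> lam * K%:R <= 2^-1 ->
  0 <= beta <= 2 * lam * s%:~R - 4 * K%:R * (lam * K%:R) ^+ 2 ->
  excess xi = s -> 0 < t ->
  (transience_prob X P xi t
   <= (K%:R * expR (2 * (lam * K%:R ^+ 3) - beta * t))%:E)%E.
Proof.
move=> s0 lam0 lamK hbeta es t0; have mE := measurable_event XP (ltW t0).
pose N : set (Gamma K) := [set eta | excess eta != excess xi].
pose T x : set (Gamma K) :=
  [set eta | (excess eta == s) && (height eta x < 0)].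
have sub : X t @^-1` @transient K
    `<=` X t @^-1` N `|` \bigcup_(x in [set` enum 'I_K]) X t @^-1` T x.
  move=> w /= /transient_trap[x xx].
  have [e|e] := eqVneq (excess (X t w)) s; last by left; rewrite /N /= es.
  by right; exists x; rewrite /= ?mem_enum // /T /= e eqxx.
have mU : measurable (\bigcup_(x in [set` enum 'I_K]) X t @^-1` T x).
  by rewrite -preimage_bigcup; exact: mE.
apply: le_trans (le_measure (P xi) _ _ sub) _.
- by rewrite inE; exact: mE.
- by rewrite inE; apply: measurableU => //; exact: mE.
apply: le_trans (measureU2 (P xi) (mE _) mU) _.
rewrite [X in (X + _)%E](excess_conserved xi t t0) add0e.
apply: (@le_trans _ _
    (\sum_(x \in [set` enum 'I_K]) P xi (X t @^-1` T x))%E).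
  apply: content_sub_fsum => // x _; exact: mE.
rewrite -fsbig_seq ?enum_uniq // big_enum /=.
apply: (@le_trans _ _ (\sum_(x < K)
    (expR (2 * (lam * K%:R ^+ 3) - beta * t))%:E)%E).
  by apply: lee_sum => x _; apply: trap_survival.
rewrite sumEFin sumr_const card_ord; set e := expR _.
by rewrite mulr_natl.
Qed.

End Survival.

(** With [y = delta K / 8], [exp (2 y) >= y^2] because [exp y >= y], and
    [K + 1 <= 2 K]. *)
Lemma decay_harmonic {R : realType} (delta : R) (K : nat) :
  0 < delta -> (0 < K)%N ->
  K%:R * expR (- (delta * K%:R / 4)) <= 128 / delta ^+ 2 * K.+1%:R^-1.
Proof.
move=> d0 K0; have K1 : 1 <= K%:R :> R by rewrite ler1n.
set k : R := K%:R in K1 *.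
rewrite expRN ler_pdivrMr ?expR_gt0 //.
have -> : delta * k / 4 = 2%:R * (delta * k / 8) by field.
rewrite expRM_natl -(natr1 K) -/k.
have H : delta * k / 8 <= expR (delta * k / 8).
  by apply: le_trans (expR_ge1Dx _); rewrite lerDr.
have H2 : (delta * k / 8) ^+ 2 <= expR (delta * k / 8) ^+ 2.
  by rewrite lerXn2r ?nnegrE ?expR_ge0 //; nra.
have c0 : 0 <= 128 / delta ^+ 2 * (k + 1)^-1.
  by rewrite !mulr_ge0 ?invr_ge0 ?sqr_ge0 //; lra.
apply: le_trans (ler_wpM2l c0 H2).
have -> : 128 / delta ^+ 2 * (k + 1)^-1 * (delta * k / 8) ^+ 2
    = 2 * k ^+ 2 / (k + 1).
  by field; rewrite gt_eqF //= gt_eqF //; lra.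
rewrite ler_pdivlMr; nra.
Qed.

Theorem mainTheorem8 (R : realType) (delta : R) (hdelta : 0 < delta < 1) :
  exists2 tdelta : R, 0 < tdelta &
    forall (d : nat -> measure_display)
      (Omega : forall K : nat, measurableType (d K))
      (X : forall K : nat, R -> Omega K -> Gamma K)
      (P : forall K : nat, Gamma K -> probability (Omega K) R),
      (forall K : nat, (0 < K)%N -> SWT_process (X K) (P K)) ->
      limn_esup (fun K : nat =>
        pSWT (X K) (P K) (Num.floor (delta * K%:R)) (tdelta * K%:R ^+ 2)) = 0%E.
Proof.
have /andP[d0 d1] := hdelta.
have t0 : 0 < 8 / delta by rewrite divr_gt0.
exists (8 / delta) => // d Omega X P XP.
suff cv : (fun K : nat => pSWT (X K) (P K) (Num.floor (delta * K%:R))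
    (8 / delta * K%:R ^+ 2)) @ \oo --> 0%E.
  by rewrite is_cvg_limn_esupE; [exact: cvg_lim|exact: cvgP cv].
apply: (@squeeze_cvge _ _ _ _ (fun=> 0%E) _
  (fun K => (128 / delta ^+ 2 * K.+1%:R^-1)%:E)); last 2 first.
- exact: cvg_cst.
- apply: cvg_EFin; first exact: nearW.
  rewrite -[X in _ --> X](mulr0 (128 / delta ^+ 2)).
  by apply: cvgMr; exact: cvg_harmonic.
(* For [K >= 2 / delta] the floor of [delta K] is at least [delta K / 2]. *)
exists (Num.trunc (2 / delta)).+1 => // K /= KK.
have K0 : (0 < K)%N by exact: leq_ltn_trans KK.
have Kd : 2 / delta <= K%:R.
  by apply: ltW; apply: lt_le_trans (truncnS_gt _) _; rewrite ler_nat.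
have dK : 2 <= delta * K%:R by rewrite mulrC -ler_pdivrMr.
set s := Num.floor (delta * K%:R).
have s0 : 0 <= s by rewrite floor_ge0; lra.
have k0 : 0 < K%:R :> R by rewrite ltr0n.
have sK : s <= K%:Z.
  rewrite -(ler_int R); apply: le_trans (floor_le _) _.
  by rewrite -[leRHS]mul1r ler_wpM2r // ltW.
have ss : delta * K%:R / 2 <= s%:~R.
  by have := floorD1_gt (delta * K%:R); rewrite -/s intrD; lra.
apply/andP; split.
  have [xi xis] := exists_excess (K := K) s (introT andP (conj s0 sK)).
  apply: (@le_trans _ _ (transience_prob (X K) (P K) xi (8 / delta * K%:R ^+ 2))).
    exact: measure_ge0.
  by apply: ereal_sup_ubound; exists xi.
apply: ge_ereal_sup => _ [xi xis <-].
(* This [lam] keeps the second-order term at half of the drift when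
   [s >= delta K / 2], and leaves the decay rate [beta]. *)
pose lam : R := delta / 8 / K%:R ^+ 2.
pose beta : R := delta ^+ 2 / 16 / K%:R.
have lamK : lam * K%:R = delta / 8 / K%:R by rewrite /lam; field; rewrite gt_eqF.
have K1 : 1 <= K%:R :> R by rewrite ler1n.
have lam0 : 0 <= lam by rewrite !divr_ge0 // ?exprn_ge0 // ltW.
apply: (@le_trans _ _ (K%:R * expR (- (delta * K%:R / 4)))%:E); last first.
  by rewrite lee_fin decay_harmonic.
have -> : - (delta * K%:R / 4)
    = 2 * (lam * K%:R ^+ 3) - beta * (8 / delta * K%:R ^+ 2).
  by rewrite /lam /beta; field; rewrite !gt_eqF.
apply: (transience_bound (XP K K0) s) => //.
- rewrite lamK ler_pdivrMr //; lra.
- rewrite !divr_ge0 ?sqr_ge0 //=.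
  have ls : 2 * lam * (delta * K%:R / 2) <= 2 * lam * s%:~R.
    by rewrite ler_wpM2l // mulr_ge0.
  apply: le_trans (lerB ls (lexx _)).
  suff -> : beta = 2 * lam * (delta * K%:R / 2) - 4 * K%:R * (lam * K%:R) ^+ 2.
    exact: lexx.
  by rewrite lamK /lam /beta; field; rewrite gt_eqF.
- by rewrite mulr_gt0 // exprn_gt0.
Qed.
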